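(* Let $(E,\mathcal I)$ be a simple matroid with finite ground set $E$ and independent sets $\mathcal I$. Declare the $\phi$-classes to be the flats (closed sets) of the matroid. Then: (1) for every $u\subseteq E$, the $\phi$-common region $\operatorname{cm}_\phi(u)$ equals the matroid closure $\operatorname{cl}(u)$; (2) two subsets $u,v\subseteq E$ are $\phi$-equivalent if and only if $\operatorname{cl}(u)=\operatorname{cl}(v)$; (3) a nonempty subset of $E$ is $\phi$-prime if and only if it is an independent set of the matroid; (4) the $\phi$-dimension number of every nonempty subset of $E$ equals its matroid rank; (5) if $E$ is nonempty, then $E$ is $\phi$-maximal; moreover, every $\phi$-prime set is $\phi$-axial; (6) $(E,\phi)$ is a geometrical system in the generalized sense of Whitehead.
   Context: Whitehead's terminology. Let $E$ be a set and let some subsets of $E$ be designated as $\phi$-classes. For $u\subseteq E$, the $\phi$-common region $\operatorname{cm}_\phi(u)$ is the intersection of all $\phi$-classes containing $u$ (the intersection of the empty family being $E$). Two subsets $u,v\subseteq E$ are $\phi$-equivalent if $\operatorname{cm}_\phi(u)=\operatorname{cm}_\phi(v)$. A nonempty set $u\subseteq E$ is $\phi$-prime if no proper subset of $u$ has the same $\phi$-common region as $u$. A $\phi$-prime set is $\phi$-axial if it has the largest cardinality among all $\phi$-prime sets having the same $\phi$-common region. For nonempty $u\subseteq E$, the $\phi$-dimension number $\dim_\phi(u)$ is the cardinality of a $\phi$-axial set that is $\phi$-equivalent to $u$. A nonempty set $u\subseteq E$ is $\phi$-maximal if every $\phi$-prime subset of $u$ that is $\phi$-equivalent to $u$ is $\phi$-axial.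 $(E,\phi)$ is a geometrical system in the generalized sense of Whitehead if: ($\lambda$) $E$ is a $\phi$-class; ($\mu$) for every $x\in E$ the singleton $\{x\}$ is a $\phi$-class; ($\nu'$) $\dim_\phi(E)$ is finite and $\operatorname{cm}_\phi(\emptyset)=\emptyset$; ($\pi$) for every $u\subseteq E$ and every $\phi$-axial subset $v$ of $\operatorname{cm}_\phi(u)$, there exists $w\subseteq E$ such that $v\cup w$ is $\phi$-axial and $\phi$-equivalent to $u$; ($\rho$) for all $\phi$-axial $u,v\subseteq E$ with $|u\cap v|\ge 2$, the set $u\cup v$ is $\phi$-maximal. A simple matroid is a matroid with no loops and no parallel pairs; $\operatorname{cl}$ denotes the matroid closure operator and flats are sets $F$ with $\operatorname{cl}(F)=F$. *)

(* Defs.v *)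
From mathcomp Require Import all_boot.
From mathcomp Require Import boolp classical_sets functions cardinality.

Set Implicit Arguments.
Unset Strict Implicit.
Unset Printing Implicit Defensive.

Local Open Scope classical_set_scope.
Local Open Scope card_scope.

Section Whitehead.
Variables (E : Type) (phi : set (set E)).
Implicit Types u v w c : set E.

(* With no class above [u], the intersection is [setT]. *)
Definition common_region u : set E :=
  \bigcap_(c in [set c | phi c /\ u `<=` c]) c.

Definition phi_equiv u v : Prop := common_region u = common_region v.

Definition phi_prime u : Prop :=
  u !=set0 /\ forall v, v `<` u -> common_region v <> common_region u.

Definition phi_axial u : Prop :=
  phi_prime u /\ forall v, phi_prime v -> phi_equiv v u -> v #<= u.

(* The dimension number of [u] is a cardinal, hence a relation here: it is the
   natural number [n].  Two phi-equivalent axial sets are equipotent by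
   definition of [phi_axial], so at most one [n] is related to [u]; there is
   none when the dimension number is infinite or when [u] is equivalent to no
   axial set. *)
Definition dim_number u (n : nat) : Prop :=
  exists v, [/\ phi_axial v, phi_equiv v u & v #= `I_n].

Definition phi_maximal u : Prop :=
  u !=set0 /\
  forall v, v `<=` u -> phi_prime v -> phi_equiv v u -> phi_axial v.

Record geometrical_system : Prop := GeometricalSystem {
  gs_lambda : phi [set: E];
  gs_mu : forall x : E, phi [set x];
  (* Dimension numbers are only defined for nonempty sets, so finiteness is
     only required of a nonempty [E]. *)
  gs_nu_dim : [set: E] !=set0 -> exists n, dim_number [set: E] n;
  gs_nu_cm0 : common_region set0 = set0;
  gs_pi : forall u v, phi_axial v -> v `<=` common_region u ->
    exists w, phi_axial (v `|` w) /\ phi_equiv (v `|` w) u;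
  gs_rho : forall u v, phi_axial u -> phi_axial v -> `I_2 #<= u `&` v ->
    phi_maximal (u `|` v) }.

End Whitehead.

Record matroid (E : finType) := Matroid {
  indep : {set {set E}};
  indep0 : finset.set0 \in indep;
  indep_sub : forall I J : {set E}, I \subset J -> J \in indep -> I \in indep;
  indep_aug : forall I J : {set E}, I \in indep -> J \in indep ->
    #|I| < #|J| -> exists2 x, x \in J :\: I & x |: I \in indep }.

Section Matroid.
Variables (E : finType) (M : matroid E).
Implicit Types (A : {set E}) (x y : E).

Definition rank A : nat := \max_(I in indep M | I \subset A) #|I|.

Definition cl A : {set E} := [set x | rank (x |: A) == rank A]%SET.

Definition flat A : Prop := cl A = A.

Definition loop x : Prop := [set x]%SET \notin indep M.

Definition parallel x y : Prop :=
  [/\ x <> y, ~ loop x, ~ loop y & [set x; y]%SET \notin indep M].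

Definition simple_matroid : Prop :=
  (forall x, ~ loop x) /\ (forall x y, ~ parallel x y).

Definition flat_classes : set (set E) :=
  [set c | exists2 F : {set E}, flat F & c = [set` F]].

End Matroid.

(* Main.v *)
(** For the classes of flats, the common region of [u] is the smallest flat
    above [u], that is [cl u]; equivalence is equality of closures, and prime
    sets are the nonempty sets minimal among those with a given closure, that
    is the nonempty independent sets. Since [rank (cl u) = rank u], equivalent
    independent sets have the same cardinality, so every prime set is axial.
    This makes every nonempty set maximal, whence axiom (rho), while axiom (pi)
    is the extension of an independent subset of [cl u] to a basis of it. *)

Require Import Defs.
From mathcomp Require Import all_boot.
From mathcomp Require Import boolp classical_sets functions cardinality.

Set Implicit Arguments.
Unset Strict Implicit.
Unset Printing Implicit Defensive.

Local Open Scope classical_set_scope.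

(** * Rank and closure derived from the augmentation axiom *)

Section MatroidTheory.
Variables (E : finType) (M : matroid E).
Implicit Types (A B I J : {set E}) (x y : E).

Lemma leq_rank I A : I \in indep M -> I \subset A -> #|I| <= rank M A.
Proof. by move=> iI sIA; rewrite /rank (leq_bigmax_cond I) // iI. Qed.

Lemma rank_le n A :
  (forall I, I \in indep M -> I \subset A -> #|I| <= n) -> rank M A <= n.
Proof. by move=> h; apply/bigmax_leqP => I /andP[]; exact: h. Qed.

Lemma rank_leq_card A : rank M A <= #|A|.
Proof. by apply: rank_le => I _; exact: subset_leq_card. Qed.

Lemma rank_mono A B : A \subset B -> rank M A <= rank M B.
Proof.
move=> sAB; apply: rank_le => I iI sIA.
by apply: leq_rank => //; exact: fintype.subset_trans sAB.
Qed.

Lemma rank_attained A :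
  exists I, [/\ I \in indep M, I \subset A & #|I| = rank M A].
Proof.
pose P I := (I \in indep M) && (I \subset A).
have [|I /andP[iI sIA] rI] := @eq_bigmax_cond _ P (fun I => #|I|); last first.
  by exists I; split; rewrite // -rI.
(* The maximum is attained because it ranges over a nonempty family: the empty set is an independent
   subset of [A]. *)
by apply/card_gt0P; exists finset.set0; rewrite unfold_in /P indep0 finset.sub0set.
Qed.

Lemma rank_indep I : I \in indep M -> rank M I = #|I|.
Proof. by move=> iI; apply/eqP; rewrite eqn_leq rank_leq_card leq_rank. Qed.

(** Induction on the deficit [rank M A - #|I|]: augmenting [I] from a maximum independent subset of
    [A] stays inside [A] and lowers the deficit by one. *)
Lemma indep_extend I A : I \in indep M -> I \subset A ->
  exists J, [/\ J \in indep M, I \subset J, J \subset A & #|J| = rank M A].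
Proof.
move En: (rank M A - #|I|) => n; elim: n I En => [|n IHn] I En iI sIA.
  by exists I; split=> //; apply/eqP; rewrite eqn_leq leq_rank //= -subn_eq0 En.
have [B [iB sBA rB]] := rank_attained A.
have ltIB : #|I| < #|B| by rewrite rB -subn_gt0 En.
have [x /finset.setDP[xB xI] ixI] := indep_aug iI iB ltIB.
have [||J [iJ sxIJ sJA rJ]] := IHn _ _ ixI.
- by rewrite cardsU1 xI add1n subnS En.
- by rewrite finset.subUset finset.sub1set (fintype.subsetP sBA).
by exists J; split=> //; apply: fintype.subset_trans sxIJ; exact: finset.subsetUr.
Qed.

Lemma cl_extensive A : A \subset cl M A.
Proof.
by apply/fintype.subsetP => x xA; rewrite inE (finset.setUidPr _) // finset.sub1set.
Qed.

Lemma subset_cl A B : A \subset B -> rank M B = rank M A -> B \subset cl M A.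
Proof.
move=> sAB rAB; apply/fintype.subsetP => x xB; rewrite inE eqn_leq.
rewrite [X in _ && X]rank_mono ?finset.subsetUr // andbT -rAB rank_mono //.
by rewrite finset.subUset finset.sub1set xB.
Qed.

(** If the rank grew, augmenting a basis [I] of [A] from a basis of [cl M A] would give an
    independent [x |: I] with [rank M A + 1] elements inside [x |: A], although [x] in the closure
    means that [x |: A] has the rank of [A]. *)
Lemma rank_cl A : rank M (cl M A) = rank M A.
Proof.
apply/eqP; rewrite eqn_leq [X in _ && X]rank_mono ?cl_extensive // andbT leqNgt.
apply/negP => lt_r; have [I [iI sIA rI]] := rank_attained A.
have [J [iJ sJc rJ]] := rank_attained (cl M A).
have [|x /finset.setDP[xJ xI] ixI] := indep_aug iI iJ; first by rewrite rI rJ.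
have /eqP rx : rank M (x |: A)%SET == rank M A.
  by have := fintype.subsetP sJc x xJ; rewrite inE.
have := leq_rank ixI (finset.setUS [set x]%SET sIA).
by rewrite cardsU1 xI rx rI add1n ltnn.
Qed.

Lemma cl_idem A : cl M (cl M A) = cl M A.
Proof.
apply/eqP; rewrite finset.eqEsubset cl_extensive andbT.
apply: subset_cl; last by rewrite !rank_cl.
by apply: fintype.subset_trans (cl_extensive _); exact: cl_extensive.
Qed.

(** Suppose [x] lies in [cl M A] but raises the rank of [B]. Extend a basis [I] of [A] to a basis
    [J] of [B]; then [x |: J] is independent, hence so is [x |: I], which is too large for
    [x |: A]. *)
Lemma cl_mono A B : A \subset B -> cl M A \subset cl M B.
Proof.
move=> sAB; apply/fintype.subsetP => x; rewrite !inE => /eqP rxA.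
rewrite eqn_leq [X in _ && X]rank_mono ?finset.subsetUr // andbT leqNgt.
apply/negP => lt_r; have [I [iI sIA rI]] := rank_attained A.
have [J [iJ sIJ sJB rJ]] := indep_extend iI (fintype.subset_trans sIA sAB).
have [K [iK sKxB rK]] := rank_attained (x |: B)%SET.
have [|y /finset.setDP[yK yJ] iyJ] := indep_aug iJ iK; first by rewrite rJ rK.
(* [J] already has [rank M B] elements, so the augmenting element cannot come from [B]. *)
have yx : y = x.
  have /finset.setU1P[//|yB] := fintype.subsetP sKxB y yK.
  have : #|(y |: J)%SET| <= rank M B.
    by apply: leq_rank => //; rewrite finset.subUset finset.sub1set yB.
  by rewrite cardsU1 yJ add1n rJ ltnn.
subst y; have xI : x \notin I by apply: contra yJ; exact: fintype.subsetP.
have := leq_rank (indep_sub (finset.setUS _ sIJ) iyJ) (finset.setUS [set x]%SET sIA).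
by rewrite cardsU1 xI rxA rI add1n ltnn.
Qed.

(** Equal rank puts [B] inside [cl M A], and idempotence bounds [cl M B] by [cl M A]. A set and a
    basis of it are thereby phi-equivalent. *)
Lemma eq_cl A B : A \subset B -> rank M B = rank M A -> cl M A = cl M B.
Proof.
move=> sAB rAB; apply/eqP; rewrite finset.eqEsubset cl_mono //=.
by rewrite -(cl_idem A) cl_mono // subset_cl.
Qed.

Lemma cl_rank A B : cl M A = cl M B -> rank M A = rank M B.
Proof. by move=> e; rewrite -rank_cl e rank_cl. Qed.

(** * Closures of the empty set and of singletons in a simple matroid *)

Hypothesis simpleM : simple_matroid M.

Lemma simple_indep1 x : [set x]%SET \in indep M.
Proof. by apply/negP => lx; apply: (simpleM.1 x); apply/negP. Qed.

Lemma simple_indep2 x y : x <> y -> [set x; y]%SET \in indep M.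
Proof.
move=> xy; apply/negP => pxy; apply: (simpleM.2 x y).
by split=> //; [exact: simpleM.1|exact: simpleM.1|exact/negP].
Qed.

Lemma simple_cl0 : cl M finset.set0 = finset.set0.
Proof.
apply/setP => x; rewrite !inE finset.setU0 !rank_indep ?indep0 ?simple_indep1 //.
by rewrite cards1 cards0.
Qed.

(** Without loops or parallel pairs, any [y] other than [x] raises the rank from 1 to 2. *)
Lemma simple_cl1 x : cl M [set x]%SET = [set x]%SET.
Proof.
apply/setP => y; rewrite !inE; case: (y =P x) => [->|yx].
  by rewrite finset.setUid eqxx.
rewrite (rank_indep (simple_indep1 x)) (rank_indep (simple_indep2 yx)) cards1 cards2.
by case: (y =P x) yx.
Qed.

End MatroidTheory.

(** * Transfer between classical sets and finite sets *)

Section FiniteSets.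
Variable E : finType.
Implicit Types (A B : {set E}) (u : set E).

Lemma set_finsetP u : exists A, u = [set` A].
Proof.
exists [set x | `[< u x >]]%SET.
by apply/seteqP; split=> x /=; rewrite inE => /asboolP.
Qed.

Lemma subset_finset A B : ([set` A] `<=` [set` B]) <-> A \subset B.
Proof.
by split=> [h|/fintype.subsetP h] => [|x /h//]; apply/fintype.subsetP => x /h.
Qed.

Lemma finset_inj A B : [set` A] = [set` B] -> A = B.
Proof.
move=> e; apply/eqP; rewrite finset.eqEsubset.
by apply/andP; split; apply/subset_finset; rewrite e.
Qed.

Lemma proper_finset A B : ([set` A] `<` [set` B]) <-> A \proper B.
Proof.
rewrite fintype.properE /classical_sets.proper !subset_finset.
by split=> [[-> /negP]|/andP[-> /negP]].
Qed.

Lemma nonempty_finset A : ([set` A] !=set0) <-> A != finset.set0.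
Proof. by split=> [[x xA]|/finset.set0Pn[x xA]]; [apply/finset.set0Pn|]; exists x. Qed.

Lemma setU_finset A B : [set` A] `|` [set` B] = [set` (A :|: B)%SET].
Proof.
by apply/seteqP; split=> x /=; rewrite finset.in_setU => /orP.
Qed.

Lemma card_finset A : ([set` A] #= `I_#|A|)%card.
Proof.
move En: #|A| => n; elim: n A En => [|n IHn] A.
  move/eqP; rewrite cards_eq0 => /eqP->; rewrite II0 card_eq0.
  by apply/eqP/seteqP; split=> x //=; rewrite inE.
move=> An; have /card_gt0P[x xA] : 0 < #|A| by rewrite An.
apply/eq_cardSP; exists x => //.
have -> : [set` A] `\ x = [set` (A :\ x)%SET].
  apply/seteqP; split=> y /=; rewrite !inE.
    by move=> [yA /eqP yx]; rewrite yx.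
  by case/andP=> /eqP yx yA.
by apply: IHn; apply/eqP; rewrite -eqSS -An (cardsD1 x A) xA.
Qed.

Lemma finset_card_le A B : #|A| <= #|B| -> ([set` A] #<= [set` B])%card.
Proof.
move=> AB.
rewrite (card_le_eql (card_finset A)) (card_le_eqr (card_finset B)).
by rewrite card_le_II.
Qed.

Lemma finset_card_eq A n : ([set` A] #= `I_n)%card <-> n = #|A|.
Proof.
split=> [An|->]; last exact: card_finset.
by apply/card_eq_II; rewrite -(card_eql An) card_finset.
Qed.

End FiniteSets.

(** * Whitehead's notions for the classes of flats *)

Section FlatClasses.
Variables (E : finType) (M : matroid E).
Local Notation phi := (flat_classes M).
Implicit Types (A B : {set E}) (u v : set E).

(** By idempotence [cl M A] is one of the intersected classes; by monotonicity it lies in all the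
    others. *)
Lemma common_region_flat A : common_region phi [set` A] = [set` cl M A].
Proof.
apply/seteqP; split=> x /=.
  move=> /(_ [set` cl M A]); apply; split; last by apply/subset_finset/cl_extensive.
  by exists (cl M A); first exact: cl_idem.
move=> xA _ [[F flatF ->] /subset_finset sAF] /=.
by rewrite -flatF; exact: (fintype.subsetP (cl_mono M sAF)).
Qed.

Lemma phi_equiv_flat A B : phi_equiv phi [set` A] [set` B] <-> cl M A = cl M B.
Proof.
by rewrite /phi_equiv !common_region_flat; split=> [/finset_inj|->].
Qed.

Lemma phi_prime_flat A :
  phi_prime phi [set` A] <-> A != finset.set0 /\ A \in indep M.
Proof.
rewrite /phi_prime nonempty_finset.
split=> [[A0 primeA]|[A0 iA]]; split=> //.
  (* A basis [I] of [A] has the closure of [A], so primeness forces [I = A]. *)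
  have [I [iI sIA rI]] := rank_attained M A.
  have [<- //|neIA] := eqVneq I A.
  have prIA : I \proper A by rewrite finset.properEneq neIA.
  case: (primeA [set` I]); first exact/proper_finset.
  by apply/phi_equiv_flat/eq_cl => //; rewrite (rank_indep iI).
move=> v; have [B ->] := set_finsetP v.
move=> /proper_finset prBA /phi_equiv_flat /cl_rank rBA.
(* A proper subset has fewer than [#|A|] elements, so its rank cannot reach [rank M A = #|A|]. *)
have := leq_ltn_trans (rank_leq_card M B) (proper_card prBA).
by rewrite rBA rank_indep // ltnn.
Qed.

Lemma phi_prime_axial u : phi_prime phi u -> phi_axial phi u.
Proof.
have [A ->] := set_finsetP u => pA; split=> // v.
have [B ->] := set_finsetP v => /phi_prime_flat[_ iB] /phi_equiv_flat eBA.
have [_ iA] := (phi_prime_flat A).1 pA.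
apply: finset_card_le; rewrite -(rank_indep iA) -(rank_indep iB).
by rewrite (cl_rank eBA).
Qed.

Lemma phi_axial_flat A :
  phi_axial phi [set` A] <-> A != finset.set0 /\ A \in indep M.
Proof.
by rewrite -phi_prime_flat; split=> [[]//|]; exact: phi_prime_axial.
Qed.

Lemma phi_maximal_flat u : u !=set0 -> phi_maximal phi u.
Proof. by split=> // v _ /phi_prime_axial. Qed.

Hypothesis simpleM : simple_matroid M.

Lemma dim_number_flat A n : A != finset.set0 ->
  dim_number phi [set` A] n <-> n = rank M A.
Proof.
move=> /finset.set0Pn[x xA]; split=> [[v []]|->].
  have [B ->] := set_finsetP v.
  move=> /phi_axial_flat[_ iB] /phi_equiv_flat /cl_rank <- /finset_card_eq->.
  by rewrite rank_indep.
have sxA : [set x]%SET \subset A by rewrite finset.sub1set.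
(* Extending from a singleton makes the basis visibly nonempty, as an axial set must be. *)
have [I [iI sxI sIA rI]] := indep_extend (simple_indep1 simpleM x) sxA.
exists [set` I]; split; last exact/finset_card_eq.
  apply/phi_axial_flat; split=> //; apply/finset.set0Pn.
  by exists x; rewrite -finset.sub1set.
by apply/phi_equiv_flat/eq_cl => //; rewrite (rank_indep iI).
Qed.

Lemma flat_geometrical_system : geometrical_system phi.
Proof.
split.
- exists finset.setT; last by apply/seteqP; split=> x //=; rewrite inE.
  apply/eqP; rewrite finset.eqEsubset finset.subsetT; exact: cl_extensive.
- move=> x; exists [set x]%SET; first exact: simple_cl1.
  by apply/seteqP; split=> y /=; rewrite inE => /eqP.
- have [A ->] := set_finsetP [set: E] => /nonempty_finset A0.
  by exists (rank M A); apply/dim_number_flat.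
- have [A] := set_finsetP (@set0 E); have [-> e|] := eqVneq A finset.set0.
    by rewrite [in LHS]e common_region_flat simple_cl0.
  by move=> /nonempty_finset /[swap] <- [].
- move=> u v; have [A ->] := set_finsetP u; have [I ->] := set_finsetP v.
  move=> /phi_axial_flat[I0 iI]; rewrite common_region_flat => /subset_finset sIA.
  have [J [iJ sIJ sJA rJ]] := indep_extend iI sIA.
  (* The basis [J] of [cl M A] contains [I], so it serves as [w] and the union is [J] itself. *)
  exists [set` J]; rewrite setU_finset (finset.setUidPr sIJ); split.
    apply/phi_axial_flat; split=> //; apply: contraNneq I0 => J0.
    by rewrite -finset.subset0 -J0.
  apply/phi_equiv_flat; rewrite -(cl_idem M A); apply: eq_cl => //.
  by rewrite (rank_indep iJ).
- by move=> u v [[[x ux] _] _] _ _; apply: phi_maximal_flat; exists x; left.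
Qed.

End FlatClasses.

Theorem theorem2 (E : finType) (M : matroid E) (simpleM : simple_matroid M) :
  let phi := flat_classes M in
  (forall u : {set E}, common_region phi [set` u] = [set` cl M u]) /\
  (forall u v : {set E},
     phi_equiv phi [set` u] [set` v] <-> cl M u = cl M v) /\
  (forall u : {set E}, u != finset.set0 ->
     (phi_prime phi [set` u] <-> u \in indep M)) /\
  (forall u : {set E}, u != finset.set0 ->
     forall n : nat, dim_number phi [set` u] n <-> n = rank M u) /\
  (([set: E] !=set0 -> phi_maximal phi [set: E]) /\
   (forall u : set E, phi_prime phi u -> phi_axial phi u)) /\
  geometrical_system phi.
Proof.
move=> phi; split; first exact: common_region_flat.
split; first exact: phi_equiv_flat.
split; first by move=> u u0; rewrite phi_prime_flat; split=> [[]|].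
split; first by move=> u u0 n; exact: dim_number_flat.
split; last exact: flat_geometrical_system.
by split; [exact: phi_maximal_flat|exact: phi_prime_axial].
Qed.
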